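(* Let $q=4k$, where $k=2^{\ell}$ for some integer $\ell\ge 2$, and let $G=\langle a,b\rangle\le\mathfrak{S}_q$ be the group described in the context. Let $f_3$ be a permutation group polynomial over $\mathbb{F}_q$ corresponding to $G$, with permutation polynomial tuple $\underline{\beta}_{f_3}=(\beta_0,\beta_1,\ldots,\beta_{q-1})\in\mathfrak{S}_q^q$. Then there are $q!$ permutation group polynomials equivalent to $f_3$.
   Context: $\mathfrak{S}_q$ is the symmetric group on $\mathbb{F}_q=\{c_0,\ldots,c_{q-1}\}$ (a fixed enumeration); permutations are composed right to left. The permutations are $a=(c_0,c_1)(c_2,c_3)\cdots(c_{q-2},c_{q-1})$ and $$\begin{aligned}b=&(c_0,c_{2k+1},\ldots,c_{2n_1},c_{2n_1+2k+1},\ldots,c_{k-2},c_{3k-1},\;c_{k+1},c_{3k},\;c_{k+2},c_{3k+2},\ldots,c_{2(n_2+1)+k},c_{2(n_2+1)+3k},\ldots,c_{2k-2},c_{4k-2})\\&(c_{3k-2},c_{2k-1},\ldots,c_{3k-2-2n_2},c_{2k-1-2n_2},\ldots,c_{2k+2},c_{k+3},\;c_{2k},c_{k},\;c_{4k-1},c_{k-1},\ldots,c_{4k-1-2n_1},c_{k-1-2n_1},\ldots,c_{3k+1},c_{1}),\end{aligned}$$ where in each of the two cycles (of length $2k$) $n_1$ runs over $0,1,\ldots,\frac{k-2}{2}$ and $n_2$ runs over $0,1,\ldots,\frac{k-4}{2}$. It is known that $|a|=2$, $|b|=2k$, $ab=b^{k-1}a$, that $G=\langle a,b\rangle=\{b^ja^i: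 0\le j\le \frac q2-1,\ 0\le i\le 1\}$ has order $q$, and that no non-identity element of $G$ has a fixed point. Functions $\mathbb{F}_q^2\to\mathbb{F}_q$ are identified with polynomials in $\mathbb{F}_q[X_1,X_2]$ of degree less than $q$ in each variable (these are the polynomials being counted). A bivariate polynomial $f$ is a local permutation polynomial (LPP) if for every $c\in\mathbb{F}_q$ both $x\mapsto f(x,c)$ and $x\mapsto f(c,x)$ are bijections of $\mathbb{F}_q$. Bivariate LPPs are in bijection with permutation polynomial tuples, i.e. tuples $\underline{\beta}_f=(\beta_0,\ldots,\beta_{q-1})\in\mathfrak{S}_q^q$ such that $\beta_i\beta_j^{-1}$ has no fixed point for $i\ne j$, via $f(x,\beta_i(x))=c_i$ for all $x\in\mathbb{F}_q$ and all $i$. An LPP is a permutation group polynomial if the entries of its tuple form a subgroup of $\mathfrak{S}_q$, and it then corresponds to that subgroup. Two LPPs $f,g$ with tuples $(\beta_0,\ldots,\beta_{q-1})$ and $(\gamma_0,\ldots,\gamma_{q-1})$ are equivalent if there exist $\lambda,\sigma\in\mathfrak{S}_q$ with $\lambda\beta_i\sigma=\gamma_i$ for all $0\le i\le q-1$. *)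

(* Defs.v *)
From HB Require Import structures.
From mathcomp Require Import all_boot all_order all_algebra all_fingroup.
From mathcomp Require Import mpoly.

Set Implicit Arguments.
Unset Strict Implicit.
Unset Printing Implicit Defensive.

Import GRing.Theory.
Local Open Scope ring_scope.

(* The infinite family of polynomials over F is not a finType, so that a
   cardinality is expressed through a duplicate-free exhaustive list. *)
Definition has_card (T : eqType) (P : T -> Prop) (n : nat) : Prop :=
  exists s : seq T, [/\ uniq s, size s = n & forall x, x \in s <-> P x].

(* The cycle (x_0, x_1, ..., x_m) for s = [:: x_0; ...; x_m]; the default value
   1 is only taken when s has repetitions, see cycle_permE. *)
Definition cycle_perm (T : finType) (s : seq T) : {perm T} :=
  insubd (1%g : {perm T}) [ffun x => next s x].

Lemma cycle_permE (T : finType) (s : seq T) :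
  uniq s -> cycle_perm s =1 next s.
Proof.
move=> Us x.
have inj_s : injectiveb [ffun x => next s x].
  by apply/injectiveP => y z; rewrite !ffunE; apply: (can_inj (prev_next Us)).
by rewrite -pvalE /cycle_perm val_insubd inj_s ffunE.
Qed.

Section Cycles.
Local Open Scope nat_scope.

(* Indices of the elements in the two cycles of b; n1 ranges over
   0, ..., (k-2)/2 and n2 over 0, ..., (k-4)/2. *)
Definition b_cycle1 (k : nat) : seq nat :=
  flatten [seq [:: 2 * n1; 2 * n1 + 2 * k + 1] | n1 <- iota 0 ((k - 2)./2).+1]
  ++ [:: k + 1; 3 * k]
  ++ flatten [seq [:: 2 * (n2 + 1) + k; 2 * (n2 + 1) + 3 * k]
             | n2 <- iota 0 ((k - 4)./2).+1].

Definition b_cycle2 (k : nat) : seq nat :=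
  flatten [seq [:: 3 * k - 2 - 2 * n2; 2 * k - 1 - 2 * n2]
          | n2 <- iota 0 ((k - 4)./2).+1]
  ++ [:: 2 * k; k]
  ++ flatten [seq [:: 4 * k - 1 - 2 * n1; k - 1 - 2 * n1]
             | n1 <- iota 0 ((k - 2)./2).+1].

End Cycles.

Section Perms.
Variables (F : finFieldType) (q : nat) (c : q.-tuple F).

Definition cycle_of (s : seq nat) : {perm F} := cycle_perm [seq c`_i | i <- s].

(* The factors are disjoint cycles, so the order of the products (and the fact
   that the product of {perm F} composes left to right) is irrelevant. *)
Definition perm_a : {perm F} :=
  (\prod_(i < q./2) cycle_of [:: (2 * i)%N; (2 * i + 1)%N])%g.

Definition perm_b (k : nat) : {perm F} :=
  (cycle_of (b_cycle1 k) * cycle_of (b_cycle2 k))%g.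

Definition groupG (k : nat) : {group {perm F}} :=
  <<[set perm_a; perm_b k]>>%G.

End Perms.

Section LPP.
Variable F : finFieldType.

Definition eval2 (f : {mpoly F[2]}) (x y : F) : F := f.@[tnth [tuple x; y]].

(* The polynomials identified with the functions F^2 -> F. *)
Definition reduced (f : {mpoly F[2]}) : Prop :=
  forall m : 'X_{1..2}, m \in msupp f -> forall i : 'I_2, (m i < #|F|)%N.

Definition lpp (f : {mpoly F[2]}) : Prop :=
  reduced f /\
  forall z : F, bijective (fun x => eval2 f x z)
                /\ bijective (fun x => eval2 f z x).

Variables (q : nat) (c : q.-tuple F).

Definition ppt (beta : 'I_q -> {perm F}) : Prop :=
  forall i j : 'I_q, i != j ->
  forall x : F, beta i ((beta j)^-1%g x) <> x.

Definition is_tuple_of (f : {mpoly F[2]}) (beta : 'I_q -> {perm F}) : Prop :=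
  ppt beta /\ forall (i : 'I_q) (x : F), eval2 f x (beta i x) = tnth c i.

(* group_set does not depend on the direction of composition. *)
Definition perm_group_poly (f : {mpoly F[2]}) : Prop :=
  lpp f /\
  exists2 beta : 'I_q -> {perm F},
    is_tuple_of f beta & group_set [set beta i | i : 'I_q].

Definition equivalent (f g : {mpoly F[2]}) : Prop :=
  exists beta gamma : 'I_q -> {perm F},
    [/\ is_tuple_of f beta, is_tuple_of g gamma
      & exists lambda sigma : {perm F},
          forall i : 'I_q, lambda \o beta i \o sigma =1 gamma i].

End LPP.

(* Main.v *)
(** If the tuple [beta] enumerates [G], then [G] is regular, since distinct
    entries of [beta] never agree at a point and there are [q = #|F|] of them.
    If [gamma_i = lambda beta_i sigma] enumerates a group, the identity is some
    [gamma_j], so that [gamma_i = (g beta_i)^p] (left to right) with [p] a permutation and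
    [g \in G].  Fix a point [x0].  Since [G] is regular, such a tuple is
    determined by the bijection [i |-> gamma_i x0], and every bijection occurs:
    [p] can be normalised by [g (p^-1 x0) = x0], which determines [g] by [p] and
    gives [gamma_i x0 = p (beta_i x0)].  Hence there are [q!] tuples, and
    reduced polynomials correspond to their tuples by interpolation. *)
Require Import Defs.
From HB Require Import structures.
From mathcomp Require Import all_boot all_order all_algebra all_fingroup.
From mathcomp Require Import mpoly.

Set Implicit Arguments.
Unset Strict Implicit.
Unset Printing Implicit Defensive.

Import GRing.Theory.

(** * Reduced bivariate polynomials as functions on F^2 *)

Section Interpolation.
Local Open Scope ring_scope.
Variable F : finFieldType.

Definition bimon (i j : nat) : 'X_{1..2} := [multinom [tuple i; j]].

(** Coefficient matrices form a finite type, which allows counting arguments on reduced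
    polynomials. *)
Definition bipoly (A : 'M[F]_#|F|) : {mpoly F[2]} :=
  \sum_i \sum_j A i j *: 'X_[bimon i j].

Lemma bimonE (m : 'X_{1..2}) : bimon (m ord0) (m ord_max) = m.
Proof.
apply/mnmP=> i; rewrite multinomE (tnth_nth 0%N).
by case: i => [[|[|i]] Hi] //=; congr (m _); apply: val_inj.
Qed.

Lemma bimon_inj (i j i' j' : nat) :
  (bimon i j == bimon i' j') = (i == i') && (j == j').
Proof.
apply/eqP/andP=> [e | [/eqP-> /eqP->] //].
have e0 := congr1 (fun m : 'X_{1..2} => m ord0) e.
have e1 := congr1 (fun m : 'X_{1..2} => m ord_max) e.
by move: e0 e1; rewrite !multinomE !(tnth_nth 0%N) /= => -> ->.
Qed.

Lemma mcoeff_bipoly (A : 'M[F]_#|F|) (m : 'X_{1..2}) :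
  (bipoly A)@_m = \sum_i \sum_j A i j * (bimon i j == m)%:R.
Proof.
rewrite raddf_sum; apply: eq_bigr => i _; rewrite raddf_sum.
by apply: eq_bigr => j _; rewrite /= mcoeffZ mcoeffX.
Qed.

Lemma mcoeff_bipoly_bimon (A : 'M[F]_#|F|) (i j : 'I_#|F|) :
  (bipoly A)@_(bimon i j) = A i j.
Proof.
rewrite mcoeff_bipoly (bigD1 i) //= (bigD1 j) //= eqxx mulr1.
rewrite !big1 ?addr0 // => [i' ne_i | j' ne_j].
- by rewrite big1 // => j' _; rewrite bimon_inj (negbTE (ne_i : i' != i :> nat)) mulr0.
- by rewrite bimon_inj (negbTE (ne_j : j' != j :> nat)) andbF mulr0.
Qed.

Lemma reduced_bipoly (A : 'M[F]_#|F|) : reduced (bipoly A).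
Proof.
move=> m; rewrite mcoeff_msupp mcoeff_bipoly => nz i.
case: (ltnP (m i) #|F|) => // le_Fm; case/eqP: nz.
rewrite big1 // => j _; rewrite big1 // => j' _.
case: eqP => [e | _]; last by rewrite mulr0.
move: le_Fm; rewrite -e multinomE (tnth_nth 0%N) leqNgt.
by case: i => [[|[|i]] Hi] //=; rewrite ltn_ord.
Qed.

Lemma reduced_bipolyE (f : {mpoly F[2]}) :
  reduced f -> f = bipoly (\matrix_(i, j) f@_(bimon i j)).
Proof.
move=> red_f; apply/mpolyP=> m.
case: (boolP ((m ord0 < #|F|) && (m ord_max < #|F|))%N) => [/andP[lt0 lt1] | ge_F].
  by rewrite -(bimonE m) (mcoeff_bipoly_bimon _ (Ordinal lt0) (Ordinal lt1)) mxE.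
have notin (g : {mpoly F[2]}) : reduced g -> g@_m = 0.
  move=> red_g; apply/eqP; apply: contraNT ge_F; rewrite -mcoeff_msupp => m_g.
  by rewrite !red_g.
by rewrite !notin //; apply: reduced_bipoly.
Qed.

Lemma eval2_bipoly (A : 'M[F]_#|F|) (x y : F) :
  eval2 (bipoly A) x y = \sum_i (\sum_j A i j * y ^+ j) * x ^+ i.
Proof.
rewrite /eval2 raddf_sum; apply: eq_bigr => i _; rewrite raddf_sum mulr_suml.
apply: eq_bigr => j _; rewrite /= mevalZ mevalX -mulrA; congr (_ * _).
by rewrite big_ord_recl big_ord1 !multinomE !(tnth_nth 0%N) !(tnth_nth 0) /= mulrC.
Qed.

(** A univariate polynomial of degree less than #|F| that has every element of F as a root is
    zero. *)
Lemma poly_fun_eq0 (a : 'I_#|F| -> F) :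
  (forall x, \sum_i a i * x ^+ i = 0) -> forall i, a i = 0.
Proof.
(* [insub] extends [a] to natural numbers; its default 0 is never read below #|F|. *)
move=> a0 i; pose p : {poly F} := \poly_(j < #|F|) (if insub j is Some k then a k else 0).
have pE j : p`_(val j) = a j by rewrite coef_poly ltn_ord valK.
suff p0: p = 0 by rewrite -pE p0 coef0.
apply: (@roots_geq_poly_eq0 _ p (enum F)); rewrite ?enum_uniq -?cardE ?size_poly //.
apply/allP=> x _; apply/eqP; rewrite horner_poly -[RHS](a0 x).
by apply: eq_bigr => j _; rewrite valK.
Qed.

Lemma eval2_bipoly_inj (A B : 'M[F]_#|F|) :
  (forall x y, eval2 (bipoly A) x y = eval2 (bipoly B) x y) -> A = B.
Proof.
move=> eAB; apply/matrixP=> i j; apply/eqP; rewrite -subr_eq0; apply/eqP.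
move: j; apply: (@poly_fun_eq0 (fun j => A i j - B i j)) => y; move: i.
apply: (@poly_fun_eq0 (fun i => \sum_j (A i j - B i j) * y ^+ j)) => x.
move/eqP: (eAB x y); rewrite !eval2_bipoly -subr_eq0 -sumrB => /eqP e; rewrite -[RHS]e.
apply: eq_bigr => i _; rewrite -mulrBl -sumrB; congr (_ * _).
by apply: eq_bigr => j _; rewrite mulrBl.
Qed.

Lemma reduced_inj (f g : {mpoly F[2]}) :
  reduced f -> reduced g -> (forall x y, eval2 f x y = eval2 g x y) -> f = g.
Proof.
move=> /reduced_bipolyE-> /reduced_bipolyE-> efg.
by congr bipoly; apply: eval2_bipoly_inj.
Qed.

(** Evaluation is injective on coefficient matrices, and there are as many of these as functions on
    F^2, so it is also onto. *)
Lemma interpolation (h : F -> F -> F) :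
  exists2 f : {mpoly F[2]}, reduced f & forall x y, eval2 f x y = h x y.
Proof.
pose ev (A : 'M[F]_#|F|) := [ffun xy : F * F => eval2 (bipoly A) xy.1 xy.2].
have ev_inj : injective ev.
  move=> A B /ffunP eAB; apply: eval2_bipoly_inj => x y.
  by have := eAB (x, y); rewrite !ffunE.
have [|ev' _ evK] := inj_card_bij ev_inj.
  by rewrite card_ffun card_prod card_mx.
exists (bipoly (ev' [ffun xy => h xy.1 xy.2])); first exact: reduced_bipoly.
move=> x y; have /ffunP/(_ (x, y)) := evK [ffun xy => h xy.1 xy.2].
by rewrite !ffunE.
Qed.

End Interpolation.

(** * Local permutation polynomials and their tuples *)

Section Tuples.
Variables (F : finFieldType) (q : nat) (c : q.-tuple F).
Hypotheses (cardF : #|F| = q) (Uc : uniq c).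

Lemma tnth_inj : injective (tnth c).
Proof. by apply/tuple_uniqP. Qed.

Lemma ppt_injP (beta : 'I_q -> {perm F}) :
  ppt beta <-> forall x, injective (fun i => beta i x).
Proof.
split=> [pb x i j eij | inj i j ne_ij x e].
  by apply/eqP/negPn/negP=> /pb/(_ (beta j x)); rewrite permK.
by case/eqP: ne_ij; apply: (inj (((beta j)^-1)%g x)); rewrite /= permKV.
Qed.

Lemma ppt_bij (beta : 'I_q -> {perm F}) (x : F) :
  ppt beta -> bijective (fun i => beta i x).
Proof.
by move/ppt_injP/(_ x)=> inj; apply: inj_card_bij => //; rewrite card_ord cardF.
Qed.

Lemma tuple_of_ext (f : {mpoly F[2]}) (beta gamma : 'I_q -> {perm F}) :
  lpp f -> is_tuple_of c f beta -> is_tuple_of c f gamma -> beta =1 gamma.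
Proof.
move=> [_ lf] [_ tb] [_ tg] i; apply/permP=> x.
by apply: (bij_inj (lf x).2); rewrite /= tb tg.
Qed.

Lemma tuple_of_inj (f g : {mpoly F[2]}) (gamma : 'I_q -> {perm F}) :
  reduced f -> reduced g -> is_tuple_of c f gamma -> is_tuple_of c g gamma ->
  f = g.
Proof.
move=> rf rg [pg tf] [_ tg]; apply: reduced_inj => // x y.
by have [gi _ giK] := ppt_bij x pg; rewrite -(giK y) tf tg.
Qed.

Lemma ppt_lpp (gamma : 'I_q -> {perm F}) :
  ppt gamma -> exists2 f, lpp f & is_tuple_of c f gamma.
Proof.
move=> pg; pose idx x y := [pick i | gamma i x == y].
(* The default 0 is never taken, as each y is gamma_i(x) for exactly one i. *)
have [f rf ev] := interpolation (fun x y => if idx x y is Some i then tnth c i else 0%R).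
have tf i x : eval2 f x (gamma i x) = tnth c i.
  rewrite ev /idx; case: pickP => [j /eqP e | /(_ i)]; last by rewrite eqxx.
  by congr (tnth c _); apply: ((ppt_injP gamma).1 pg x).
exists f => //; split=> // z; split; apply: injF_bij => x y.
(* Write z as gamma_i(x) and as gamma_j(y): equal values force i = j, and then x = y. *)
- have [gx _ gxK] := ppt_bij x pg; have [gy _ gyK] := ppt_bij y pg.
  rewrite -[in LHS](gxK z) -[in RHS](gyK z) !tf => /tnth_inj e.
  by apply: (@perm_inj _ (gamma (gx z))); rewrite /= (gxK z) e (gyK z).
- have [gz _ gzK] := ppt_bij z pg.
  by rewrite -(gzK x) -(gzK y) !tf => /tnth_inj->.
Qed.

End Tuples.

(** * Translates of a regular group that are again groups *)

Section RegularTuples.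
Local Open Scope group_scope.
Variables (F I : finType) (beta : I -> {perm F}) (G : {group {perm F}}) (x0 : F).
Hypotheses (betaG : [set beta i | i : I] = G)
  (beta_bij : forall x, bijective (fun i => beta i x)).

Lemma beta_in i : beta i \in G.
Proof. by rewrite -betaG imset_f. Qed.

Lemma beta_onto (g : {perm F}) : g \in G -> exists i, g = beta i.
Proof. by rewrite -betaG => /imsetP[i _ ->]; exists i. Qed.

Lemma regular_free (g h : {perm F}) (x : F) :
  g \in G -> h \in G -> g x = h x -> g = h.
Proof.
by move=> /beta_onto[i ->] /beta_onto[j ->] /(bij_inj (beta_bij x))->.
Qed.

Lemma regular_trans (x y : F) : exists2 g, g \in G & g x = y.
Proof. by have [b _ bK] := beta_bij x; exists (beta (b y)); rewrite ?beta_in ?bK. Qed.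

(** Regularity makes the set a singleton, so [repr] picks the one element of G that normalises p. *)
Definition shift (p : {perm F}) : {perm F} := repr [set g in G | g (p^-1 x0) == x0].

Lemma shiftP (p : {perm F}) : shift p \in G /\ shift p (p^-1 x0) = x0.
Proof.
have [g Gg gx] := regular_trans (p^-1 x0) x0.
suff: shift p \in [set g in G | g (p^-1 x0) == x0] by rewrite inE => /andP[-> /eqP].
by apply: (@mem_repr _ _ g); rewrite inE Gg gx eqxx.
Qed.

Definition conj_tuple (p : {perm F}) (i : I) : {perm F} := (shift p * beta i) ^ p.

Lemma conj_tupleE (p : {perm F}) (i : I) :
  conj_tuple p i = (p^-1 * shift p) * beta i * p.
Proof. by rewrite /conj_tuple conjgE !mulgA. Qed.

Lemma conj_tuple_x0 (p : {perm F}) (i : I) : conj_tuple p i x0 = p (beta i x0).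
Proof. by rewrite conj_tupleE !permM (shiftP p).2. Qed.

Lemma conj_tuple_inj (p r : {perm F}) : conj_tuple p =1 conj_tuple r -> p = r.
Proof.
move=> epr; apply/permP=> x; have [b _ bK] := beta_bij x0.
by rewrite -(bK x) -!conj_tuple_x0 epr.
Qed.

Lemma conj_tuple_at_inj (p : {perm F}) (x : F) :
  injective (fun i => conj_tuple p i x).
Proof.
move=> i j; rewrite !conj_tupleE !permM => /perm_inj.
exact: bij_inj (beta_bij _) _ _.
Qed.

(** Left multiplication by [shift p] permutes G, so the entries form the conjugate of G by p. *)
Lemma conj_tuple_group (p : {perm F}) : group_set [set conj_tuple p i | i : I].
Proof.
suff ->: [set conj_tuple p i | i : I] = G :^ p by apply: groupP.
have [Gs _] := shiftP p.
apply/setP=> g; apply/imsetP/imsetP=> [[i _ ->] | [h Gh ->]].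
  by exists (shift p * beta i); rewrite ?groupM ?beta_in.
have [|i e] := @beta_onto ((shift p)^-1 * h); first by rewrite groupM ?groupV.
by exists i; rewrite // /conj_tuple -e mulKVg.
Qed.

Lemma conj_tuple_onto (gamma : I -> {perm F}) (sigma lambda : {perm F}) :
  (forall i, gamma i = sigma * beta i * lambda) ->
  group_set [set gamma i | i : I] -> exists p, gamma =1 conj_tuple p.
Proof.
(* The entry [gamma j] equal to the identity expresses sigma through lambda and [beta j]. *)
move=> gE /andP[/imsetP[j _ gj1] _].
have sE : sigma = lambda^-1 * (beta j)^-1.
  by rewrite -invMg; apply/eqP; rewrite eq_mulgV1 invgK mulgA -gE -gj1.
have [b bK Kb] := beta_bij x0.
(* By [conj_tuple_x0], p must send beta_i(x0) to gamma_i(x0); this defines it. *)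
have p_inj : injective (fun x => gamma (b x) x0).
  move=> x y; rewrite !gE !permM => /perm_inj/(bij_inj (beta_bij _)).
  exact: (can_inj Kb).
pose p := perm p_inj; exists p.
have pE i : p (beta i x0) = gamma i x0 by rewrite permE bK.
(* Both elements of G send p^-1(x0) = beta_j(x0) to x0, so they coincide by freeness. *)
have shp : shift p = (beta j)^-1.
  have [Gs sx] := shiftP p; apply: (@regular_free _ _ (p^-1 x0)) => //.
    by rewrite groupV beta_in.
  rewrite sx; suff ->: p^-1 x0 = beta j x0 by rewrite permK.
  by apply: (@perm_inj _ p); rewrite permKV pE -gj1 perm1.
pose y := sigma x0.
have ph g : g \in G -> p (g x0) = lambda (g y).
  by case/beta_onto=> i ->; rewrite pE gE !permM.
move=> i; rewrite gE sE conj_tupleE shp.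
have GK : (beta j)^-1 * beta i \in G by rewrite groupM ?groupV ?beta_in.
apply: (mulgI p); rewrite -!mulgA mulKVg; apply/permP=> x.
(* At x = h(x0), [ph] applied to h and to h followed by beta_j^-1 beta_i identifies the two
   sides. *)
have [h Gh <-] := regular_trans x0 x.
have := ph _ (groupM Gh GK); rewrite !permM => ->.
by rewrite ph // permK.
Qed.

End RegularTuples.

(** * Counting the equivalent permutation group polynomials *)

Theorem proposition4p17 (l k q : nat) (hl : 2 <= l) (hk : k = 2 ^ l)
  (hq : q = 4 * k) (F : finFieldType) (hF : #|F| = q)
  (c : q.-tuple F) (hc : uniq c)
  (f3 : {mpoly F[2]}) (beta : 'I_q -> {perm F})
  (hf3 : perm_group_poly c f3) (hbeta : is_tuple_of c f3 beta)
  (hG : [set beta i | i : 'I_q] = groupG c k) :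
  has_card (fun g : {mpoly F[2]} => perm_group_poly c g /\ equivalent c f3 g)
    q`!.
Proof.
have bij_beta x : bijective (fun i => beta i x) by apply: ppt_bij => //; case: hbeta.
pose Gamma := conj_tuple beta (groupG c k) 0%R.
have Gamma_ppt p : ppt (Gamma p).
  by apply/ppt_injP=> x; apply: conj_tuple_at_inj.
have [P PP] : exists P : {perm F} -> {mpoly F[2]},
    forall p, lpp (P p) /\ is_tuple_of c (P p) (Gamma p).
  apply: (@fin_all_exists _ _ (fun p f => lpp f /\ is_tuple_of c f (Gamma p))) => p.
  by have [f lf tf] := ppt_lpp hF hc (Gamma_ppt p); exists f.
exists [seq P p | p <- enum {: {perm F}}]; split.
- rewrite map_inj_uniq ?enum_uniq // => p r ePpr.
  apply: (conj_tuple_inj hG bij_beta (x0 := 0%R)).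
  by apply: (tuple_of_ext (PP p).1 (PP p).2); rewrite ePpr; case: (PP r).
- rewrite size_map -cardE -hF -(cardsT F) -card_perm.
  by apply: eq_card => p; rewrite inE; apply/esym/subsetP=> x; rewrite inE.
- move=> g; split=> [/mapP[p _ ->] | [[lg [gamma' tg' grp]]]].
    have [lP tP] := PP p; split.
      by split=> //; exists (Gamma p) => //; exact: (conj_tuple_group 0%R hG bij_beta p).
    exists beta, (Gamma p); split=> //.
    (* The two factors around [beta i] in [conj_tupleE]; products in {perm F} act from left to
       right. *)
    exists p, (p^-1 * shift (groupG c k) 0%R p)%g => i x.
    by rewrite /= [Gamma p i]conj_tupleE !permM.
  case=> beta' [gamma [tb tg [lambda [sigma e]]]].
  (* The equivalence and the group condition bring their own tuples; uniqueness of the tuple of an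
     LPP identifies them. *)
  have ebb := tuple_of_ext hf3.1 tb hbeta.
  have [||p eg] := @conj_tuple_onto _ _ _ _ 0%R hG bij_beta gamma sigma lambda.
  + by move=> i; apply/permP=> x; rewrite -e /= ebb !permM.
  + by rewrite -(eq_imset _ (tuple_of_ext lg tg' tg)).
  apply/mapP; exists p; first by rewrite mem_enum.
  have [lP tP] := PP p.
  apply: (tuple_of_inj hF lg.1 lP.1 _ tP).
  case: tg => _ tg; split=> [|i x]; first exact: Gamma_ppt.
  by rewrite -[Gamma p i]eg.
Qed.
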